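(* Let $f(X)=\mathrm{trace}(X^{1/2})$, and let $\{X_1^{(k)}\}_{k\ge 0}$ be the sequence of iterates obtained, starting from some $X_1^{(0)}$, by the fixed point iteration $$X_1^{(k+1)}=M_1+f(X_1^{(k)})\,\Lambda,\qquad k\ge 0,$$ for the equation $X_1=M_1+f(X_1)\,\Lambda$, with $M_1\succeq 0$ and $\Lambda\succeq 0$, so that the exact solution $X_1^\star$ to $X_1=M_1+f(X_1)\,\Lambda$ is symmetric and positive definite. Let $E^{(k)}=X_1^{(k)}-X_1^\star$. Then $$E^{(k+1)}=\tfrac12\,\mathrm{trace}\bigl(\Lambda\,(X_1^\star)^{-1}\bigr)\,E^{(k)}+o(\|E^{(k)}\|)\,\Lambda .$$ If $\tfrac12\,\mathrm{trace}\bigl(\Lambda\,(X_1^\star)^{-1}\bigr)=\sigma<1$, then there exist an $X_1^{(0)}$ and a $\sigma_1\in[0,1)$ such that $$\|E^{(k+1)}\|\le\sigma_1\,\|E^{(k)}\|,$$ for any matrix norm $\|\cdot\|$.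
   Context: All matrices are $n\times n$, and $\Lambda$ is diagonal. The setting arises from the matrix equation $X=M+f(X)N$ with $N=Q\Lambda Q^{-1}$ diagonalizable, by setting $X_1=Q^{-1}XQ$ and $M_1=Q^{-1}MQ$. The notation $A\succeq 0$ means that $A$ is symmetric and positive semidefinite; $X^{1/2}$ is the matrix square root of $X$; $o(\|E^{(k)}\|)$ denotes a scalar quantity of smaller order than $\|E^{(k)}\|$ as $E^{(k)}\to 0$.
   Formalization: The printed coefficient ½trace(Λ(X₁* )^{-1}) makes the expansion false; it is replaced by ½trace(Λ(X₁* )^{-1/2}) throughout. The expansion is stated for k≥1, and for k=0 only if E^(0) is a multiple of Λ; X₁^(0)⪰0 and X₁* positive definite are assumed. *)

(* Defs.v *)
From mathcomp Require Import all_boot all_order all_algebra.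
From mathcomp Require Import all_classical all_reals all_analysis.
Set Implicit Arguments.
Unset Strict Implicit.
Unset Printing Implicit Defensive.
Import Order.TTheory GRing.Theory Num.Theory.
Import numFieldNormedType.Exports.
Local Open Scope ring_scope.

Definition psdmx (R : realType) (n : nat) (A : 'M[R]_n) : Prop :=
  A^T = A /\ forall x : 'rV[R]_n, 0 <= (x *m A *m x^T) 0 0.

Definition pdmx (R : realType) (n : nat) (A : 'M[R]_n) : Prop :=
  A^T = A /\ forall x : 'rV[R]_n, x <> 0 -> 0 < (x *m A *m x^T) 0 0.

(* The square root of a positive semidefinite matrix, i.e. its unique positive
   semidefinite square root; it is 0 when A has none. *)
Definition sqrtmx (R : realType) (n : nat) (A : 'M[R]_n) : 'M[R]_n :=
  xget 0 [set S : 'M[R]_n | psdmx S /\ S *m S = A]%classic.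

Definition trsqrt (R : realType) (n : nat) (A : 'M[R]_n) : R := \tr (sqrtmx A).

Definition fixed_point_iter (R : realType) (n : nat) (M L X0 : 'M[R]_n)
    (k : nat) : 'M[R]_n :=
  iter k (fun X => M + trsqrt X *: L) X0.

(* Submultiplicativity is not required, so this includes every notion of
   matrix norm in use. *)
Definition matrix_norm (R : realType) (n : nat) (nu : 'M[R]_n -> R) : Prop :=
  [/\ forall A, 0 <= nu A,
      forall A, nu A = 0 -> A = 0,
      forall (a : R) A, nu (a *: A) = `|a| * nu A
    & forall A B, nu (A + B) <= nu A + nu B].

(* Main.v *)
Require Import Defs.
From mathcomp Require Import all_boot all_order all_algebra.
From mathcomp Require Import ring lra complex.
From mathcomp Require Import all_classical all_reals all_analysis.
Set Implicit Arguments.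
Unset Strict Implicit.
Unset Printing Implicit Defensive.
Import Order.TTheory GRing.Theory Num.Theory.
Import numFieldNormedType.Exports.
Local Open Scope ring_scope.

(** Every error of the iteration, after the first step, is a multiple of [Lam]:
    subtracting [Xs = M1 + trsqrt Xs *: Lam] from the recurrence leaves
    [E (k+1) = (trsqrt (Xs + E k) - trsqrt Xs) *: Lam].  The theorem is
    therefore about the scalar function [c |-> trsqrt (Xs + c *: Lam)] at 0, and
    all it needs is the second-order bound [trsqrt_expansion]: the derivative of
    [trsqrt] at a positive definite [A] in the direction [H] is
    [2^-1 * \tr (H *m A^(-1/2))], with an error bounded by a multiple of the
    squared Frobenius norm of [H].

    That bound is algebraic.  Put [S = A^(1/2)], [T = (A + H)^(1/2)] and
    [D = T - S].  Then [H = T^2 - S^2] can be written in two ways: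
    - [H = S D + D S + D^2]; multiplying by [S^-1] and taking traces gives
      [\tr (H S^-1) = 2 \tr D + \tr (D S^-1 D)], which is the expansion of
      [\tr D] up to a term quadratic in [D];
    - [H = T D + D S]; multiplying by [D] and taking traces gives
      [\tr (D H) = \tr (D T D) + \tr (D S D) >= m \tr (D^2)], where [m > 0]
      bounds the form of [S] from below, so that [D] is of the order of [H].
    Existence of the square roots ([psd_sqrt_exists]) comes from the spectral
    theorem over the complex numbers [R[i]], brought back to [R] by evaluating
    at [A] a real polynomial that interpolates the fourth root on the spectrum.

    For the convergence statement, [X0 = Xs + c0 *: Lam] with [c0 > 0] so small
    that the quadratic error costs at most [(1 - sigma) / 2] of the contraction;
    the rate is then [(1 + sigma) / 2].  Since all errors lie on one line, both
    parts hold in every norm at once, by homogeneity. *)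

Local Notation quad A x := ((x *m A *m x^T) 0 0).
Local Notation sqnorm x := ((x *m x^T) 0 0).

(** * Bounds on quadratic forms *)

Lemma sqnormE (R : realType) n (x : 'rV[R]_n) : sqnorm x = \sum_i x 0 i ^+ 2.
Proof. by rewrite mxE; apply: eq_bigr => i _; rewrite mxE expr2. Qed.

Lemma sqnorm_ge0 (R : realType) n (x : 'rV[R]_n) : 0 <= sqnorm x.
Proof. by rewrite sqnormE sumr_ge0 // => i _; rewrite sqr_ge0. Qed.

Lemma sqnorm_gt0 (R : realType) n (x : 'rV[R]_n) : x != 0 -> 0 < sqnorm x.
Proof.
move=> x0; rewrite lt_def sqnorm_ge0 andbT; apply: contra_neq x0 => /eqP.
rewrite sqnormE psumr_eq0 => [/allP x0|i _]; last exact: sqr_ge0.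
apply/rowP => i; rewrite mxE; apply/eqP; rewrite -sqrf_eq0.
by apply: x0; rewrite mem_index_enum.
Qed.

Lemma quad_le (R : realType) n (B : 'M[R]_n) :
  exists2 K : R, 0 <= K & forall x : 'rV[R]_n, `|quad B x| <= K * sqnorm x.
Proof.
exists (\sum_i \sum_j `|B j i|) => [|x]; first by do 2!apply: sumr_ge0 => ? _.
set N := sqnorm x; rewrite mxE mulr_suml (le_trans (ler_norm_sum _ _ _)) //.
apply: ler_sum => i _; rewrite !mxE !mulr_suml.
rewrite (le_trans (ler_norm_sum _ _ _)) //; apply: ler_sum => j _.
have coord k : `|x 0 k| ^+ 2 <= N.
  rewrite real_normK ?num_real // /N sqnormE (bigD1 k) //= lerDl.
  by apply: sumr_ge0 => ? _; rewrite sqr_ge0.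
rewrite !normrM mulrAC mulrC; apply: ler_wpM2l => //.
have := sqr_ge0 (`|x 0 i| - `|x 0 j|); rewrite sqrrB mulr2n.
by have := coord i; have := coord j; lra.
Qed.

Lemma pd_psd (R : realType) n (A : 'M[R]_n) : pdmx A -> psdmx A.
Proof.
case=> As Apd; split=> // x.
by have [->|/eqP/Apd/ltW//] := eqVneq x 0; rewrite !mul0mx mxE.
Qed.

Lemma pdmx_unit (R : realType) n (A : 'M[R]_n) : pdmx A -> A \in unitmx.
Proof.
case=> _ Apd; rewrite -row_free_unit; apply/row_freeP; apply/row_freeP.
apply: inj_row_free => v vA; apply/eqP; apply: contraT => /eqP/Apd.
by rewrite vA mul0mx mxE ltxx.
Qed.

Lemma quad_invmx (R : realType) n (A : 'M[R]_n) (x : 'rV[R]_n) :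
  A \in unitmx -> A^T = A -> quad (invmx A) x = quad A (x *m invmx A).
Proof.
by move=> Au As; rewrite trmx_mul trmx_inv As mulmxKV // mulmxA.
Qed.

Lemma quad_scale (R : realType) n (A : 'M[R]_n) (t : R) (x : 'rV[R]_n) :
  quad A (t *: x) = t ^+ 2 * quad A x.
Proof. by rewrite linearZ /= -!scalemxAl -scalemxAr scalerA mxE expr2. Qed.

Lemma psd_invmx (R : realType) n (A : 'M[R]_n) :
  psdmx A -> A \in unitmx -> psdmx (invmx A).
Proof.
move=> [As A0] Au; split=> [|x]; first by rewrite trmx_inv As.
by rewrite quad_invmx.
Qed.

(** With [y = x A^-1], positivity of the form of [A] at [x - t y] reads
    [x A x^T >= 2 t |x|^2 - t^2 (x A^-1 x^T)].  The last form is at most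
    [K |x|^2], and [t = 1 / (K + 1)] leaves at least [t |x|^2]: a lower bound
    without eigenvalues or compactness of the sphere. *)
Lemma psd_unit_coercive (R : realType) n (A : 'M[R]_n) :
  psdmx A -> A \in unitmx ->
  exists2 m : R, 0 < m & forall x : 'rV[R]_n, m * sqnorm x <= quad A x.
Proof.
move=> [As A0] Au; have [K K0 leK] := quad_le (invmx A).
exists (K + 1)^-1 => [|x]; first by rewrite invr_gt0 ltr_pwDr.
set t := _^-1; have := A0 (x - t *: (x *m invmx A)).
have -> : quad A (x - t *: (x *m invmx A)) =
    quad A x - t *+ 2 * sqnorm x + t ^+ 2 * quad (invmx A) x.
  rewrite quad_invmx // -quad_scale; set y := t *: _.
  have xAy : (x *m A *m y^T) 0 0 = t * sqnorm x.
    rewrite /y linearZ /= trmx_mul trmx_inv As -scalemxAr -!mulmxA.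
    by rewrite (mulmxA A) mulmxV // mul1mx mxE.
  have yAx : (y *m A *m x^T) 0 0 = t * sqnorm x.
    by rewrite /y -!scalemxAl mulmxKV // mxE.
  rewrite mulr2n mulrDl -{1}xAy -yAx linearB /= !mulmxBl !mulmxBr.
  by rewrite !mxE; ring.
have := leK x; rewrite ler_norml => /andP[_ qK].
have tK : t * (K + 1) = 1 by rewrite mulVf // gt_eqF // ltr_pwDr.
have t0 : 0 < t by rewrite invr_gt0 ltr_pwDr.
move=> Q0; have := ler_wpM2l (sqr_ge0 t) qK; have s0 := sqnorm_ge0 x.
(* By the choice of t, t^2 K = t - t^2. *)
have -> : t ^+ 2 * (K * sqnorm x) = (t - t ^+ 2) * sqnorm x.
  by rewrite -{2}(mulr1 t) -tK; ring.
have := mulr_ge0 (sqr_ge0 t) s0; move: Q0; rewrite mulr2n; lra.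
Qed.

(** This and the next lemma transfer the bounds on forms to matrices, row by
    row; [\tr (D *m D^T)] is the squared Frobenius norm. *)
Lemma trace_quad (R : realType) n (A D : 'M[R]_n) :
  \tr (D *m A *m D^T) = \sum_i quad A (row i D).
Proof.
by apply: eq_bigr => i _; rewrite -row_mul tr_row -[in RHS]row_mul !mxE;
  apply: eq_bigr => j _; rewrite !mxE.
Qed.

Lemma trace_sqnorm (R : realType) n (D : 'M[R]_n) :
  \tr (D *m D^T) = \sum_i sqnorm (row i D).
Proof.
by apply: eq_bigr => i _; rewrite !mxE; apply: eq_bigr => j _; rewrite !mxE.
Qed.

(** * Square roots of positive semidefinite matrices *)

Lemma interpolation (F : fieldType) (f : F -> F) (s : seq F) :
  exists p : {poly F}, {in s, forall x, p.[x] = f x}.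
Proof.
elim: s => [|a s [p ps]]; first by exists 0.
have [sa|sa] := boolP (a \in s).
  by exists p => x; rewrite inE => /predU1P[->|]; apply: ps.
pose w := \prod_(b <- s) ('X - b%:P).
have wa : w.[a] != 0 by rewrite -rootE root_prod_XsubC.
exists (p + ((f a - p.[a]) / w.[a]) *: w) => x.
rewrite inE !hornerE => /predU1P[->|xs]; first by rewrite divfK // addrC subrK.
suff -> : w.[x] = 0 by rewrite mulr0 addr0 ps.
by apply/eqP; rewrite -rootE root_prod_XsubC.
Qed.

Lemma psd_eigenvalue_ge0 (R : realType) n (A : 'M[R]_n) a :
  psdmx A -> eigenvalue A a -> 0 <= a.
Proof.
move=> [_ A0] /eigenvalueP[v vA v0]; have := A0 v.
by rewrite vA -scalemxAl mxE pmulr_lge0 // sqnorm_gt0.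
Qed.

(** The spectral theorem in the form of a statement over [R] alone: the real
    matrix is diagonalized over [R[i]], where its eigenvalues turn out to be
    real and nonnegative, and a real polynomial vanishing on them kills it. *)
Lemma psd_annihilated (R : realType) n (A : 'M[R]_n.+1) :
  psdmx A -> exists2 s : seq R, {in s, forall a, 0 <= a} &
    forall p : {poly R}, {in s, forall a, p.[a] = 0} -> horner_mx A p = 0.
Proof.
move=> Apsd; pose toC := real_complex R; pose AC := map_mx toC A.
have AC_herm : AC \is hermsymmx.
  apply: realsym_hermsym.
    apply/is_hermitianmxP; rewrite expr0 scale1r map_mx_id // map_trmx.
    by rewrite Apsd.1.
  by apply/mxOverP => i j; rewrite mxE; apply/complex_realP; exists (A i j).
have /mxOverP dR := hermitian_spectral_diag_real AC_herm.
have /hermitian_normalmx/orthomx_spectralP := AC_herm.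
have := spectral_unit AC.
set P := spectralmx AC; set d := spectral_diag AC in dR * => Pu ACE.
have dE i : d 0 i = toC (complex.Re (d 0 i)) by rewrite [RHS]RRe_real.
exists [seq complex.Re (d 0 i) | i <- enum 'I_n.+1] => [_ /mapP[i _ ->]|p p0].
  apply: (psd_eigenvalue_ge0 Apsd); rewrite -(eigenvalue_map toC) -/AC.
  apply/eigenvalueP; exists (row i P).
    rewrite ACE !mulmxA -row_mul mulmxV // row1 -rowE row_diag_mx.
    by rewrite -scalemxAl -rowE {1}dE.
  rewrite rowE mulmx_free_eq0 ?row_free_unit //.
  by apply/eqP => /matrixP/(_ 0 i)/eqP; rewrite !mxE !eqxx oner_eq0.
apply: (map_mx_inj (f := toC)); rewrite map_horner_mx map_mx0 -/AC ACE.
rewrite horner_mx_uconjC // horner_mx_diag.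
have -> : map_mx (horner (map_poly toC p)) d = 0.
  apply/matrixP => k i; rewrite !mxE ord1 dE horner_map /= p0 ?rmorph0 //.
  by apply: map_f; rewrite mem_enum.
by rewrite raddf0 mulmx0 mul0mx.
Qed.

Lemma horner_mx_sym (R : comNzRingType) n (A : 'M[R]_n.+1) (p : {poly R}) :
  A^T = A -> (horner_mx A p)^T = horner_mx A p.
Proof.
move=> As; elim/poly_ind: p => [|p c IHp]; first by rewrite rmorph0 trmx0.
rewrite rmorphD rmorphM /= horner_mx_X horner_mx_C linearD /= tr_scalar_mx.
rewrite -mulmxE trmx_mul IHp As; congr (_ + _).
exact: comm_mx_horner.
Qed.

(** The square root is [T ^ 2], where [T = q(A)] and [q] interpolates the fourth
    root on the spectrum.  Passing through the fourth root makes the result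
    visibly positive: [T] is symmetric, so [x T^2 x^T = |x T|^2]. *)
Lemma psd_sqrt_exists (R : realType) n (A : 'M[R]_n) :
  psdmx A -> exists S, psdmx S /\ S *m S = A.
Proof.
case: n A => [|n] A Apsd.
  by exists A; split=> //; apply/matrixP => -[].
have [s s0 sA] := psd_annihilated Apsd.
have [q qE] := interpolation (fun a => Num.sqrt (Num.sqrt a)) s.
pose T := horner_mx A q; have Ts : T^T = T by apply: horner_mx_sym Apsd.1.
exists (T *m T); split.
  split=> [|x]; first by rewrite trmx_mul Ts.
  have -> : x *m (T *m T) *m x^T = (x *m T) *m (x *m T)^T.
    by rewrite trmx_mul Ts !mulmxA.
  exact: sqnorm_ge0.
apply/eqP; rewrite -subr_eq0; apply/eqP.
rewrite -[RHS](sA ((q * q) * (q * q) - 'X)) => [|a sa].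
  by rewrite rmorphB !rmorphM /= horner_mx_X.
have a0 := s0 _ sa.
rewrite hornerD hornerN hornerX !hornerM qE // -!expr2.
by rewrite !sqr_sqrtr ?sqrtr_ge0 // subrr.
Qed.

Lemma sqrtmxP (R : realType) n (A : 'M[R]_n) :
  psdmx A -> psdmx (sqrtmx A) /\ sqrtmx A *m sqrtmx A = A.
Proof. by move/psd_sqrt_exists/(xgetPex 0). Qed.

(** * First-order expansion of the trace of the square root *)

(** The constant is [C = K / (2 m^2)], where [m] bounds the form of [S = A^(1/2)]
    from below and [K] bounds that of [S^-1] from above: [m] turns the size of
    [H] into the size of [D = (A + H)^(1/2) - S], and [K] controls the quadratic
    remainder [2^-1 * \tr (D S^-1 D)]. *)
Lemma trsqrt_expansion (R : realType) n (A : 'M[R]_n) : pdmx A ->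
  exists2 C : R, 0 <= C & forall H : 'M[R]_n, psdmx (A + H) ->
    `|trsqrt (A + H) - trsqrt A - 2^-1 * \tr (H *m invmx (sqrtmx A))|
      <= C * \tr (H *m H^T).
Proof.
move=> Apd; have Apsd := pd_psd Apd.
have [] := sqrtmxP Apsd; rewrite /trsqrt; set S := sqrtmx A => Spsd SS.
have Su : S \in unitmx.
  by have := pdmx_unit Apd; rewrite -SS unitmx_mul => /andP[].
have [m m0 mS] := psd_unit_coercive Spsd Su.
have [K K0 KS] := quad_le (invmx S).
exists (2^-1 * K / m ^+ 2) => [|H AHpsd].
  by rewrite !mulr_ge0 // invr_ge0 sqr_ge0.
have [] := sqrtmxP AHpsd; set T := sqrtmx (A + H) => Tpsd TT.
pose D := T - S; have DE : D = T - S by [].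
clearbody D; have Ds : D^T = D by rewrite DE linearB /= Tpsd.1 Spsd.1.
have HE : H = T *m D + D *m S.
  by rewrite DE mulmxBr mulmxBl TT SS subrKA addrAC subrr add0r.
have Hs : H^T = H.
  have : (A + H)^T = A + H by exact: AHpsd.1.
  by rewrite linearD /= Apd.1 => /addrI.
have HE' : H = S *m D + D *m S + D *m D.
  have TE : T = D + S by rewrite DE subrK.
  by rewrite {1}HE {1}TE mulmxDl -addrA addrC.
have trE : \tr (H *m invmx S) = 2 * \tr D + \tr (D *m invmx S *m D^T).
  rewrite HE' !mulmxDl !linearD /= mulmxK // mxtrace_mulC mulmxA mulVmx //.
  by rewrite mul1mx Ds -mulmxA (mxtrace_mulC D) mulrDl mul1r.
have trDH : m * \tr (D *m D^T) <= \tr (D *m H).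
  rewrite HE mulmxDr linearD /= -[leLHS]add0r lerD //.
    rewrite mulmxA -[X in _ *m X]Ds trace_quad sumr_ge0 // => i _.
    exact: Tpsd.2.
  rewrite (mxtrace_mulC D (D *m S)) -[X in _ *m _ *m X]Ds.
  rewrite trace_quad trace_sqnorm mulr_sumr.
  by apply: ler_sum => i _.
(* From |m D - H|^2 >= 0; it replaces Cauchy-Schwarz, and combined with trDH
   it bounds |D| by |H| / m. *)
have young : m * \tr (D *m H) *+ 2 <= m ^+ 2 * \tr (D *m D^T) + \tr (H *m H^T).
  have : 0 <= \tr ((m *: D - H) *m (m *: D - H)^T).
    by rewrite trace_sqnorm sumr_ge0 // => i _; exact: sqnorm_ge0.
  rewrite linearB linearZ /= Ds Hs !mulmxBl !mulmxBr -!scalemxAl -!scalemxAr.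
  rewrite !raddfB /= !mxtraceZ (mxtrace_mulC H D) mulr2n expr2; lra.
have trD : \tr (D *m D^T) <= \tr (H *m H^T) / m ^+ 2.
  rewrite ler_pdivlMr ?exprn_gt0 //.
  by have := ler_wpM2l (ltW m0) trDH; move: young; rewrite mulr2n expr2; lra.
have -> : \tr T - \tr S - 2^-1 * \tr (H *m invmx S) =
    - (2^-1 * \tr (D *m invmx S *m D^T)).
  by rewrite trE DE linearB /=; field.
rewrite normrN normrM ger0_norm // -!mulrA ler_wpM2l //.
apply: (@le_trans _ _ (K * \tr (D *m D^T))); last first.
  by rewrite ler_wpM2l // mulrC.
rewrite trace_quad trace_sqnorm mulr_sumr (le_trans (ler_norm_sum _ _ _)) //.
exact: ler_sum.
Qed.

Lemma pd_perturb (R : realType) n (A B : 'M[R]_n) : pdmx A -> B^T = B ->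
  exists2 d : R, 0 < d & forall c, `|c| <= d -> psdmx (A + c *: B).
Proof.
move=> Apd Bs; have Apsd := pd_psd Apd.
have [m m0 mA] := psd_unit_coercive Apsd (pdmx_unit Apd).
have [K K0 KB] := quad_le B.
have K1 : 0 < K + 1 by rewrite ltr_pwDr.
exists (m / (K + 1)) => [|c]; first by rewrite divr_gt0.
rewrite ler_pdivlMr // => cd; split=> [|x].
  by rewrite linearD linearZ /= Apd.1 Bs.
have -> : quad (A + c *: B) x = quad A x + c * quad B x.
  by rewrite mulmxDr mulmxDl -scalemxAr -scalemxAl !mxE.
have : `|c * quad B x| <= m * sqnorm x.
  rewrite normrM (le_trans (ler_wpM2l (normr_ge0 c) (KB x))) // mulrA.
  rewrite ler_wpM2r ?sqnorm_ge0 // (le_trans _ cd) //.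
  by rewrite ler_wpM2l // lerDl.
by rewrite ler_norml => /andP[+ _]; have := mA x; lra.
Qed.

(** [\tr (T^2 B) = \tr (T B T)] for the square root [T] of [A]. *)
Lemma psd_trace_mul_ge0 (R : realType) n (A B : 'M[R]_n) :
  psdmx A -> psdmx B -> 0 <= \tr (A *m B).
Proof.
move=> /sqrtmxP[[Ts _] <-] [_ B0]; rewrite -mulmxA mxtrace_mulC -{2}Ts.
by rewrite trace_quad sumr_ge0.
Qed.

(** * The iteration *)

Lemma matrix_norm0 (R : realType) n (nu : 'M[R]_n -> R) :
  matrix_norm nu -> nu 0 = 0.
Proof. by case=> _ _ nuZ _; rewrite -(scale0r 0) nuZ normr0 mul0r. Qed.

Lemma near_entry_small (R : realType) n (i j : 'I_n) (e : R) : 0 < e ->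
  \forall H \near (0 : 'M[R]_n), `|(H : 'M[R]_n) i j| < e.
Proof.
move=> e0.
have /cvgr_dist_lt/(_ _ e0) := @coord_continuous R n n i j (0 : 'M[R]_n).
by rewrite mxE; apply: filterS => H; rewrite sub0r normrN.
Qed.

(** Coercivity of [A] keeps [A + c *: B] positive semidefinite for small [c] of
    either sign, so the expansion holds on a whole neighbourhood of [c = 0]. *)
Lemma trsqrt_expansion_line (R : realType) n (A B : 'M[R]_n) :
  pdmx A -> B^T = B ->
  exists C d : R, [/\ 0 < C, 0 < d & forall c, `|c| <= d ->
    psdmx (A + c *: B) /\
    `|trsqrt (A + c *: B) - trsqrt A
      - 2^-1 * \tr (B *m invmx (sqrtmx A)) * c| <= C * c ^+ 2].
Proof.
move=> Apd Bs; have [d d0 dP] := pd_perturb Apd Bs.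
have [C C0 CP] := trsqrt_expansion Apd.
have B0 : 0 <= \tr (B *m B^T).
  by rewrite trace_sqnorm sumr_ge0 // => i _; exact: sqnorm_ge0.
exists (C * \tr (B *m B^T) + 1), d; split=> // [|c cd].
  by rewrite ltr_wpDl // mulr_ge0.
split; first exact: dP.
have := CP _ (dP _ cd).
rewrite (linearZ _ B) /= -!scalemxAl -scalemxAr scalerA !mxtraceZ -expr2.
rewrite mulrCA [_ * c]mulrC => /le_trans; apply.
by rewrite mulrCA mulrC ler_wpM2r ?sqr_ge0 // lerDl.
Qed.

Theorem theorem4p5 (R : realType) (n : nat) (M1 Lam Xs : 'M[R]_n)
    (n_gt0 : (0 < n)%N)
    (M1_psd : psdmx M1) (Lam_psd : psdmx Lam) (Lam_diag : is_diag_mx Lam)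
    (Xs_pd : pdmx Xs) (Xs_sol : Xs = M1 + trsqrt Xs *: Lam) :
  let E (X0 : 'M[R]_n) (k : nat) := fixed_point_iter M1 Lam X0 k - Xs in
  let sigma := 2^-1 * \tr (Lam *m invmx (sqrtmx Xs)) in
  (exists r : 'M[R]_n -> R,
     (forall nu : 'M[R]_n -> R, matrix_norm nu -> r =o_ (0 : 'M[R]_n) nu) /\
     (forall (X0 : 'M[R]_n) (k : nat), psdmx X0 ->
        (0 < k)%N \/ (exists c : R, E X0 0%N = c *: Lam) ->
        E X0 k.+1 = sigma *: E X0 k + r (E X0 k) *: Lam)) /\
  (sigma < 1 ->
   exists (X0 : 'M[R]_n) (sigma1 : R),
     [/\ psdmx X0, X0 <> Xs, 0 <= sigma1 < 1
       & forall nu : 'M[R]_n -> R, matrix_norm nu ->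
         forall k : nat, nu (E X0 k.+1) <= sigma1 * nu (E X0 k)]).
Proof.
move=> E sigma.
have ES X0 k : E X0 k.+1 = (trsqrt (Xs + E X0 k) - trsqrt Xs) *: Lam.
  rewrite /E subrKC /fixed_point_iter iterS {1}Xs_sol.
  by rewrite opprD addrACA subrr add0r -scalerBl.
(* If Lam = 0 the iteration is exact after one step, and no scalar coordinate
   can be read off a multiple of Lam. *)
have [Lam0|[i0 [j0 Lij]]] : Lam = 0 \/ exists i j, Lam i j != 0.
  have [->|Lam_neq0] := eqVneq Lam 0; [by left|right].
  by apply/matrix0Pn.
- split=> [|_].
    exists (fun=> 0); split=> [nu _|X0 k _ _].
      by apply/eqoP => e e0; near=> x; rewrite normr0 mulr_ge0 // ltW.
    by rewrite ES /sigma Lam0 mul0mx mxtrace0 mulr0 !scaler0 scale0r addr0.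
  have psd0 : psdmx (0 : 'M[R]_n).
    by split=> [|x]; rewrite ?trmx0 // mulmx0 mul0mx mxE.
  exists 0, 0; split=> // [Xs0||nu nuP k]; last 2 first.
  + by rewrite lexx ltr01.
  + by rewrite ES Lam0 scaler0 (matrix_norm0 nuP) mul0r.
  have /(Xs_pd.2 _) : (const_mx 1 : 'rV[R]_n) <> 0.
    by move=> /rowP/(_ (Ordinal n_gt0))/eqP; rewrite !mxE oner_eq0.
  by rewrite -Xs0 mulmx0 mul0mx mxE ltxx.
have [C [d [C0 d0 expand]]] := trsqrt_expansion_line Xs_pd Lam_psd.1.
rewrite -/sigma in expand.
(* coord H recovers c from H = c *: Lam, and H == coord H *: Lam tests
   whether H lies on that line. *)
pose coord (H : 'M[R]_n) := H i0 j0 / Lam i0 j0.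
have coordZ c : coord (c *: Lam) = c by rewrite /coord mxE mulfK.
have E_line X0 k : (0 < k)%N \/ (exists c : R, E X0 0%N = c *: Lam) ->
    E X0 k = coord (E X0 k) *: Lam.
  by case: k => [[//|[c ->]]|k _]; rewrite ?ES coordZ.
pose rho c := trsqrt (Xs + c *: Lam) - trsqrt Xs - sigma * c.
split.
  exists (fun H => if H == coord H *: Lam then rho (coord H) else 0).
  split=> [nu nuP|X0 k _ /E_line Ek]; last first.
    rewrite ES Ek; move: (coord (E X0 k)) => c.
    by rewrite coordZ eqxx scalerA -scalerDl /rho [_ + (_ - _)]addrC subrK.
  have nuL : 0 < nu Lam.
    case: nuP => nu_ge0 nu_eq0 _ _; rewrite lt_def nu_ge0 andbT.
    apply: contraNneq Lij => /nu_eq0 ->; by rewrite mxE.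
  apply/eqoP => e e0.
  pose b := Num.min d (e * nu Lam / C).
  have b0 : 0 < b by rewrite lt_min d0 divr_gt0 // mulr_gt0.
  have nearb : \forall H \near (0 : 'M[R]_n), `|coord H| < b.
    have := near_entry_small i0 j0 (mulr_gt0 b0 (_ : 0 < `|Lam i0 j0|)).
    rewrite normr_gt0 => /(_ Lij); apply: filterS => H.
    by rewrite normrM normfV ltr_pdivrMr ?normr_gt0.
  near=> H.
  have Hb : `|coord H| < b by near: H; exact: nearb.
  case: eqP => [HE|_]; last by rewrite normr0 mulr_ge0 // ltW.
  move: Hb; rewrite lt_min => /andP[/ltW Hd].
  rewrite ltr_pdivlMr // => /ltW HC.
  apply: (le_trans ((expand _ Hd).2)).
  have [nu_ge0 _ nuZ _] := nuP; rewrite [X in nu X]HE nuZ.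
  rewrite ger0_norm ?mulr_ge0 ?nu_ge0 //.
  rewrite -[coord H ^+ 2]real_normK ?num_real // expr2 mulrA [C * _]mulrC.
  by rewrite [`|_| * nu Lam]mulrC [leRHS]mulrA ler_wpM2r.
move=> sigma_lt1.
have sigma_ge0 : 0 <= sigma.
  rewrite mulr_ge0 // psd_trace_mul_ge0 //.
  have [Spsd SS] := sqrtmxP (pd_psd Xs_pd).
  apply: psd_invmx => //.
  by have := pdmx_unit Xs_pd; rewrite -{1}SS unitmx_mul => /andP[].
pose c0 := Num.min d ((1 - sigma) / 2 / C).
have c0_gt0 : 0 < c0 by rewrite lt_min d0 !divr_gt0 // subr_gt0.
pose s1 := (1 + sigma) / 2.
have s1P : 0 <= s1 < 1 by rewrite /s1; lra.
have contract c : `|c| <= c0 ->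
    `|trsqrt (Xs + c *: Lam) - trsqrt Xs| <= s1 * `|c|.
  rewrite le_min ler_pdivlMr // => /andP[/expand[_ cE] cC].
  rewrite -[X in `|X|](subrK (sigma * c)) (le_trans (ler_normD _ _)) //.
  rewrite normrM (ger0_norm sigma_ge0).
  have -> : s1 = (1 - sigma) / 2 + sigma by rewrite /s1; field.
  rewrite mulrDl lerD // (le_trans cE) //.
  by rewrite -real_normK ?num_real // expr2 mulrA [C * _]mulrC ler_wpM2r.
have E0 : E (Xs + c0 *: Lam) 0%N = c0 *: Lam by rewrite /E /= addrC addKr.
have Ecoord k : E (Xs + c0 *: Lam) k = coord (E (Xs + c0 *: Lam) k) *: Lam.
  by apply: E_line; right; exists c0.
have bound k : `|coord (E (Xs + c0 *: Lam) k)| <= c0.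
  elim: k => [|k IHk]; first by rewrite E0 coordZ gtr0_norm.
  rewrite ES coordZ Ecoord (le_trans (contract _ IHk)) //.
  case/andP: s1P => s1_ge0 s1_lt1; rewrite (le_trans _ IHk) //.
  by rewrite ler_piMl // ltW.
exists (Xs + c0 *: Lam), s1; split=> //.
- by apply: (expand c0 _).1; rewrite gtr0_norm // ge_min lexx.
- move=> /(canRL (addKr _)); rewrite addNr => /matrixP/(_ i0 j0)/eqP.
  by rewrite !mxE mulf_eq0 (negPf Lij) gt_eqF.
move=> nu [nu_ge0 _ nuZ _] k; rewrite ES [E _ k]Ecoord !nuZ mulrA ler_wpM2r //.
exact: contract.
Unshelve. all: by end_near.
Qed.
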